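(* Let $k$ be an algebraically closed field of characteristic $2$ and $n\ge 3$. Let $\underline{W}=(W_1,\dots,W_n)\in k[X]^n$ be such that all nonzero elements of $\langle W_1,\dots,W_n\rangle_{\mathbb{F}_2}$ are pairwise coprime and all of the same degree $d$. Set $V_i:=\Delta_{n-1}(\underline{\hat{W}_i})$ for $i=1,\dots,n$. Then there exists a rational function $\alpha\in\frac{1}{\Delta_n(\underline{W})}k[X]$ such that: (i) $Q_i:=\frac{V_i^4}{\Delta_n(\underline{W})^2}+(X+\alpha^2)V_i^2$ is a polynomial for every $i=1,\dots,n$; (ii) the forms $\omega_i:=(-1)^{i-1}\frac{\Delta_{n-1}(\underline{\hat{Q}_i})}{\Delta_n(\underline{Q})}dX$, $i=1,\dots,n$, built from $\underline{Q}=(Q_1,\dots,Q_n)$, form a basis of a space $L_{2^{n-1}\lambda,n}$ (for some positive integer $\lambda$). Moreover, given such an $\alpha$, the set of all rational functions satisfying (i) and (ii) (in place of $\alpha$) is $\{\alpha+R: R\in k[X]\}$.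
   Context: The Moore determinant (here $p=2$) is $\Delta_n(a_1,\dots,a_n)=\det\big(a_j^{2^{i-1}}\big)_{1\le i,j\le n}$; $\underline{\hat{W}_i}$ is $\underline{W}$ with $W_i$ removed. The hypothesis implies $\Delta_n(\underline{W})\neq0$. A meromorphic differential form $f(X)dX$ on $\mathbb{P}^1_k$ is logarithmic if it equals $dF/F$ for some nonzero $F\in k(X)$; its order at $\infty$ is $\mathrm{ord}_0(f(1/X))-2$. For positive integers $m,n$, a space $L_{m+1,n}$ is an $n$-dimensional $\mathbb{F}_2$-vector space of meromorphic differential forms on $\mathbb{P}^1_k$ whose nonzero elements are all logarithmic and each have a unique zero, located at $\infty$, of order $m-1$. *)

(* Defs.v *)
From HB Require Import structures.
From mathcomp Require Export all_boot all_order all_algebra.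
From mathcomp Require Export fraction generic_quotient.
From mathcomp Require Import ring zify.

Set Implicit Arguments.
Unset Strict Implicit.
Unset Printing Implicit Defensive.

Import Order.TTheory GRing.Theory Num.Theory.
Local Open Scope ring_scope.
Local Open Scope quotient_scope.

Notation "x %:F" := (@FracField.tofrac _ x) : ring_scope.

Definition Moore (R : comNzRingType) (n : nat) (a : 'I_n -> R) : R :=
  \det (\matrix_(i < n, j < n) a j ^+ (2 ^ i)).

Definition omit (T : Type) (n : nat) (a : 'I_n -> T) (i : 'I_n) : 'I_n.-1 -> T :=
  fun j => a (lift i j).

(* The representative in {0, 1} of c 0 i acts as a multiplicity; this is the
   F_2-action whenever V is 2-torsion. *)
Definition F2comb (V : nmodType) (n : nat) (a : 'I_n -> V) (c : 'rV['F_2]_n) : V :=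
  \sum_(i < n) a i *+ c 0 i.

Definition F2basis (V : nmodType) (n : nat) (a : 'I_n -> V) (L : V -> Prop) : Prop :=
  (forall c : 'rV['F_2]_n, F2comb a c = 0 -> c = 0) /\
  (forall x : V, L x <-> exists c : 'rV['F_2]_n, x = F2comb a c).

Section RationalFunctions.

Variable k : fieldType.
Implicit Types (f : {fraction {poly k}}) (p q : {poly k}) (a : k).

(* Numerator and denominator of an arbitrary representative, not necessarily
   reduced; fderivE, fordE and fsubVXE show that the choice is immaterial. *)
Definition fnum f : {poly k} := \n_(repr f).
Definition fden f : {poly k} := \d_(repr f).

Lemma fden_neq0 f : fden f != 0. Proof. exact: denom_ratioP. Qed.

Lemma fracE f : f = (fnum f)%:F / (fden f)%:F.
Proof.
have d0 : (fden f)%:F != 0 :> {fraction {poly k}} by rewrite tofrac_eq0 fden_neq0.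
apply: (mulIf d0); rewrite mulfVK //.
rewrite /fnum /fden; move: (reprK f); move: (repr f) => -[[x y] /= y0] <-.
unlock FracField.tofrac; rewrite -[LHS]FracField.pi_mul.
apply/eqmodP; rewrite /= FracField.equivfE /FracField.mulf.
by rewrite !numden_Ratio ?mul1r ?mulr1 ?oner_neq0 //= mulrC.
Qed.

Lemma frac_cross p q : q != 0 ->
  fnum (p%:F / q%:F) * q = p * fden (p%:F / q%:F).
Proof.
move=> q0; set f := p%:F / q%:F.
apply/eqP; rewrite -tofrac_eq !rmorphM /=; apply/eqP.
have := fracE f; rewrite {1}/f => /eqP.
by rewrite eqr_div ?tofrac_eq0 ?fden_neq0 // => /eqP ->.
Qed.

Lemma fnum_neq0 f : f != 0 -> fnum f != 0.
Proof.
by apply: contraNneq => n0; rewrite (fracE f) n0 rmorph0 mul0r.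
Qed.

Definition fderiv f : {fraction {poly k}} :=
  ((fnum f)^`() * fden f - fnum f * (fden f)^`())%:F / (fden f ^+ 2)%:F.

Lemma fderivE p q : q != 0 ->
  fderiv (p%:F / q%:F) = (p^`() * q - p * q^`())%:F / (q ^+ 2)%:F.
Proof.
move=> q0; have := frac_cross p q0; have := fden_neq0 (p%:F / q%:F).
rewrite /fderiv /=; set N := fnum _; set D := fden _ => D0 e.
apply/eqP; rewrite eqr_div ?tofrac_eq0 ?expf_neq0 //.
rewrite -!rmorphM /= tofrac_eq; apply/eqP.
have e' : N^`() * q + N * q^`() = p^`() * D + p * D^`().
  by rewrite -!derivM e.
have -> : (N^`() * D - N * D^`()) * q ^+ 2
  = D * q * (N^`() * q + N * q^`()) - (N * q) * (D * q^`() + q * D^`()) by ring.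
rewrite e' e; ring.
Qed.

(* order of vanishing at a, negative at poles; irrelevant for f = 0 *)
Definition ford a f : int := (mup a (fnum f))%:Z - (mup a (fden f))%:Z.

Lemma fordE a p q : p != 0 -> q != 0 ->
  ford a (p%:F / q%:F) = (mup a p)%:Z - (mup a q)%:Z.
Proof.
move=> p0 q0; have := frac_cross p q0; have := fden_neq0 (p%:F / q%:F).
have := @fnum_neq0 (p%:F / q%:F).
rewrite mulf_neq0 ?invr_eq0 ?tofrac_eq0 // => /(_ isT).
rewrite /ford; set N := fnum _; set D := fden _ => N0 D0 /(congr1 (mup a)).
rewrite !mupM // => /(congr1 Posz); rewrite !PoszD => e.
by apply/eqP; rewrite subr_eq addrAC eq_sym subr_eq -e.
Qed.

Definition psubVX p : {fraction {poly k}} :=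
  (map_poly (fun c : k => c%:P%:F) p).['X%:F^-1].

(* f(1/X) *)
Definition fsubVX f : {fraction {poly k}} := psubVX (fnum f) / psubVX (fden f).

Lemma psubVXM p q : psubVX (p * q) = psubVX p * psubVX q.
Proof.
by rewrite /psubVX (rmorphM (map_poly (@FracField.tofrac {poly k} \o polyC))) hornerM.
Qed.

Lemma psubVX_eq0 p : (psubVX p == 0) = (p == 0).
Proof.
apply/eqP/eqP => [|->]; last by rewrite /psubVX map_poly0 horner0.
have X0 : 'X%:F != 0 :> {fraction {poly k}} by rewrite tofrac_eq0 polyX_eq0.
rewrite /psubVX (@horner_coef_wide _ (size p)) ?size_poly // => e.
have : (\poly_(i < size p) p`_(size p - i.+1))%:F = 0 :> {fraction {poly k}}.
  rewrite -[RHS](mulr0 ('X%:F ^+ (size p).-1)) -e poly_def rmorph_sum mulr_sumr.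
  rewrite (reindex_inj rev_ord_inj) /=; apply: eq_bigr => i _.
  rewrite coef_map_id0 ?rmorph0 //.
  rewrite subnSK // (subKn (ltnW _)) //= -mul_polyC rmorphM rmorphXn /=.
  rewrite mulrCA; congr (_ * _); rewrite exprVn.
  apply: (mulIf (expf_neq0 i X0)); rewrite mulfVK ?expf_neq0 // -exprD.
  by congr (_ ^+ _); have := ltn_ord i; lia.
move/eqP; rewrite tofrac_eq0 => /eqP /polyP e'.
apply/eqP; rewrite -lead_coef_eq0 lead_coefE.
have := e' 0%N; rewrite coef_poly coef0 subn1; case: ltnP => [_ -> //|].
by rewrite leqn0 size_poly_eq0 => /eqP ->; rewrite coef0.
Qed.

Lemma fsubVXE p q : q != 0 -> fsubVX (p%:F / q%:F) = psubVX p / psubVX q.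
Proof.
move=> q0; apply/eqP; rewrite eqr_div ?psubVX_eq0 ?fden_neq0 //.
by rewrite -!psubVXM frac_cross.
Qed.

(* A meromorphic differential form f dX on the projective line is encoded by its
   coefficient f in k(X). *)
Definition logarithmic f : Prop :=
  exists F : {fraction {poly k}}, F != 0 /\ f = fderiv F / F.

(* dX has no zero or pole at finite points, so the order of f dX at a is ford a f. *)
Definition form_ord_infty f : int := ford 0 (fsubVX f) - 2.

(* M is the first index of the space, i.e. m + 1. *)
Definition is_Lspace (M n : nat) (L : {fraction {poly k}} -> Prop) : Prop :=
  exists m : nat,
    [/\ M = m.+1, (0 < m)%N, (0 < n)%N,
        exists w : 'I_n -> {fraction {poly k}}, F2basis w L &
        forall f, L f -> f != 0 ->
          [/\ logarithmic f,
              forall a, ford a f <= 0 &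
              form_ord_infty f = m%:Z - 1]].

Section Construction.

Variables (n : nat) (W : 'I_n -> {poly k}).

Definition Vpol (i : 'I_n) : {poly k} := Moore (omit W i).

Definition Qrat (alpha : {fraction {poly k}}) (i : 'I_n) : {fraction {poly k}} :=
  (Vpol i)%:F ^+ 4 / (Moore W)%:F ^+ 2
  + ('X%:F + alpha ^+ 2) * (Vpol i)%:F ^+ 2.

Definition omega (alpha : {fraction {poly k}}) (i : 'I_n) : {fraction {poly k}} :=
  (-1) ^+ i * (Moore (omit (Qrat alpha) i) / Moore (Qrat alpha)).

Definition Q_polynomial (alpha : {fraction {poly k}}) : Prop :=
  forall i : 'I_n, exists P : {poly k}, Qrat alpha i = P%:F.

Definition omega_spans_Lspace (alpha : {fraction {poly k}}) : Prop :=
  exists (lambda : nat) (L : {fraction {poly k}} -> Prop),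
    [/\ (0 < lambda)%N, is_Lspace (2 ^ n.-1 * lambda) n L &
        F2basis (omega alpha) L].

End Construction.

End RationalFunctions.

(* Main.v *)
Require Import Defs.
From mathcomp Require Import ring zify.

Set Implicit Arguments.
Unset Strict Implicit.
Unset Printing Implicit Defensive.

Import GRing.Theory.
Local Open Scope ring_scope.

(** For a nonzero linear form [l] on [F_2^n], the Moore determinant factors as
    [Moore a = a^_l * prod_(l(c) = 1) a_c], where [a^_l] is the combination with
    coefficients [l] of the [Moore (omit a i)].  Applied to [Q], it shows that
    each nonzero combination of the forms [omega_i] is [1 / prod_(l(c) = 1) Q_c],
    hence has no finite zero; clearing denominators,
    [D^2 Q_c = (V_c (V_c + P))^2 + X (V_c D)^2] for [alpha = P / D], so all [Q_c]
    have the same degree.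

    In characteristic 2, [f dX] is logarithmic as soon as [f' = f^2].  For the
    [omega_i] this holds whatever [alpha] is: since [Q_i' = V_i^2], it reduces to
    one quadratic identity between the sums [sum_i (V_i / D)^(2^s) omega_i], which
    follows from the minimal additive relation satisfied by the [V_i / D].

    Hence (ii) follows from (i).  Applied to [W], the factorisation turns (i) into
    the congruences [P = V_l] modulo [W_w] for [l(w) = 1], which are consistent
    and solvable by the Chinese remainder theorem.  Two solutions differ by a
    polynomial because the [V_i] have no common root. *)

(** * Linear forms on F_2^n and their level sets *)

Lemma F2_cases (x : 'F_2) : x = 0 \/ x = 1.
Proof. by case: x => [[|[|m]] lt2] //; [left | right]; apply: val_inj. Qed.

Section Dot.
Variable n : nat.
Implicit Types (l c : 'rV['F_2]_n).

Definition dot l c : 'F_2 := \sum_(i < n) l 0 i * c 0 i.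

Lemma dotDr l c c' : dot l (c + c') = dot l c + dot l c'.
Proof. by rewrite /dot -big_split; apply: eq_bigr => i _; rewrite mxE mulrDr. Qed.

Lemma dotDl l l' c : dot (l + l') c = dot l c + dot l' c.
Proof. by rewrite /dot -big_split; apply: eq_bigr => i _; rewrite mxE mulrDl. Qed.

Lemma dot_deltar l i : dot l (delta_mx 0 i) = l 0 i.
Proof.
rewrite /dot (bigD1 i) //= big1 ?addr0 => [|j jNi]; rewrite mxE !eqxx ?mulr1 //.
by rewrite (negPf jNi) mulr0.
Qed.

Lemma dot_deltal c i : dot (delta_mx 0 i) c = c 0 i.
Proof.
rewrite /dot (bigD1 i) //= big1 ?addr0 => [|j jNi]; rewrite mxE !eqxx ?mul1r //.
by rewrite (negPf jNi) mul0r.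
Qed.

Lemma rVF2_neq0 c : c != 0 -> exists i, c 0 i = 1.
Proof.
case/rV0Pn=> i ci; exists i; by case: (F2_cases (c 0 i)) ci => -> //; rewrite eqxx.
Qed.

Lemma dot0r l : dot l 0 = 0.
Proof. by rewrite /dot big1 // => i _; rewrite mxE mulr0. Qed.

Lemma dot_eq0F l c : (dot l c == 0) = (dot l c != 1).
Proof. by case: (F2_cases (dot l c)) => ->. Qed.

(** Translation by [c0] exchanges the two level sets of the form. *)
Lemma card_dot0 l c0 : dot l c0 = 1 ->
  #|[pred c | dot l c == 0]| = #|[pred c | dot l c == 1]|.
Proof.
move=> lc0; rewrite -(card_image (addIr c0)); apply: eq_card => c.
rewrite inE; apply/imageP/eqP => [[c' /eqP lc' ->]|lc].
  by rewrite dotDr lc0 lc' add0r.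
exists (c - c0); last by rewrite subrK.
by rewrite inE -(inj_eq (addIr (dot l c0))) -dotDr subrK lc lc0.
Qed.

Lemma card_dot1 l : l != 0 -> #|[pred c | dot l c == 1]| = (2 ^ n.-1)%N.
Proof.
move=> l0; have [i li] := rVF2_neq0 l0.
have n0 : (0 < n)%N by apply: leq_ltn_trans (ltn_ord i).
have e := @card_dot0 l (delta_mx 0 i) (etrans (dot_deltar l i) li).
have := cardC [pred c | dot l c == 0]; rewrite card_mx card_Fp // mul1n e.
rewrite (@eq_card _ (predC _) [pred c | dot l c == 1]); last first.
  by move=> c; rewrite !inE dot_eq0F negbK.
have -> : (2 ^ n = 2 ^ n.-1 * 2)%N by rewrite -expnSr prednK.
by rewrite addnn -muln2 => /eqP; rewrite eqn_mul2r => /eqP.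
Qed.

End Dot.

(** * Frobenius powers and F_2-combinations in characteristic 2 *)

Section Frobenius.
Variables (R : comNzRingType) (chR : 2%N \in [pchar R]).

Lemma sumrX2 (I : Type) (r : seq I) (P : pred I) (F : I -> R) s :
  (\sum_(i <- r | P i) F i) ^+ (2 ^ s) = \sum_(i <- r | P i) F i ^+ (2 ^ s).
Proof.
elim/big_rec2: _ => [|i x y _ <-]; first by rewrite expr0n expn_eq0.
by rewrite exprDn_pchar // pnatX pnatE // chR.
Qed.

Lemma mulrnX2 (x : R) (c : 'F_2) s : (x *+ c) ^+ (2 ^ s) = x ^+ (2 ^ s) *+ c.
Proof.
by case: (F2_cases c) => ->; rewrite ?mulr1n // !mulr0n expr0n expn_eq0.
Qed.

Lemma F2combX2 n (a : 'I_n -> R) c s :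
  F2comb a c ^+ (2 ^ s) = F2comb (fun j => a j ^+ (2 ^ s)) c.
Proof. by rewrite sumrX2; apply: eq_bigr => i _; rewrite mulrnX2. Qed.

(** The coefficient on the left is reduced modulo 2, so characteristic 2 enters when both
    coefficients are 1. *)
Lemma mulrn_F2D (x : R) (c c' : 'F_2) : x *+ (c + c')%R = x *+ c + x *+ c'.
Proof.
case: (F2_cases c) => ->; first by rewrite add0r mulr0n add0r.
case: (F2_cases c') => ->; first by rewrite addr0 mulr0n addr0.
by rewrite mulr1n (addrr_pchar2 chR).
Qed.

Lemma F2combD n (a : 'I_n -> R) c c' : F2comb a (c + c') = F2comb a c + F2comb a c'.
Proof.
by rewrite /F2comb -big_split; apply: eq_bigr => i _; rewrite mxE mulrn_F2D.
Qed.

Lemma F2comb0 n (a : 'I_n -> R) : F2comb a 0 = 0.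
Proof. by rewrite /F2comb big1 // => i _; rewrite mxE mulr0n. Qed.

Lemma F2comb_delta n (a : 'I_n -> R) i : F2comb a (delta_mx 0 i) = a i.
Proof.
rewrite /F2comb (bigD1 i) //= big1 ?addr0 => [|j jNi]; rewrite mxE !eqxx ?mulr1n //.
by rewrite (negPf jNi) mulr0n.
Qed.

Lemma F2comb_inj n (a : 'I_n -> R) :
  (forall c : 'rV['F_2]_n, c != 0 -> F2comb a c != 0) -> injective (F2comb a).
Proof.
move=> a0 c c' e; apply/eqP; rewrite -subr_eq0; apply: contraT => /a0.
have -> : c - c' = c + c'.
  apply/rowP=> i; rewrite !mxE; congr (_ + _).
  by case: (F2_cases (c' 0 i)) => ->; apply: val_inj.
by rewrite F2combD e (addrr_pchar2 chR) eqxx.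
Qed.

Lemma sign_pchar2 i : (-1) ^+ i = 1 :> R.
Proof. by rewrite (oppr_pchar2 chR) expr1n. Qed.

Lemma F2combE n (a : 'I_n -> R) (c : 'rV['F_2]_n) :
  F2comb a c = \sum_(j < n) (c 0 j : nat)%:R * a j.
Proof. by apply: eq_bigr => i _; rewrite mulr_natl. Qed.

End Frobenius.

(** * Cofactor identities for the Moore matrix *)

Definition Moore_mx (R : comNzRingType) n (a : 'I_n -> R) : 'M[R]_n :=
  \matrix_(i < n, j < n) a j ^+ (2 ^ i).

Section MooreRing.
Variables (R : comNzRingType) (chR : 2%N \in [pchar R]) (m : nat).
Implicit Type a : 'I_m.+1 -> R.

Lemma cofactor_Moore_last a j : cofactor (Moore_mx a) ord_max j = Moore (omit a j).
Proof.
rewrite /cofactor sign_pchar2 // mul1r; congr (\det _).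
by apply/matrixP=> i l; rewrite !mxE lift_max.
Qed.

(** Without its first row, the matrix has all exponents shifted by one, so the minor is the
    Frobenius image of the smaller Moore determinant. *)
Lemma cofactor_Moore_first a j :
  cofactor (Moore_mx a) ord0 j = Moore (omit a j) ^+ 2.
Proof.
rewrite /cofactor sign_pchar2 // mul1r -[RHS](pFrobenius_autE chR).
rewrite /Moore -det_map_mx; congr (\det _).
by apply/matrixP=> i l; rewrite !mxE lift0 /= expnSr exprM.
Qed.

Lemma sum_Moore_cofactor a j l :
  \sum_(i < m.+1) a j ^+ (2 ^ i) * cofactor (Moore_mx a) i l = Moore a *+ (j == l).
Proof.
have /matrixP /(_ l j) := mul_adj_mx (Moore_mx a).
rewrite !mxE eq_sym => <-; apply: eq_bigr => i _.
by rewrite mxE [Moore_mx a i j]mxE mulrC.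
Qed.

(** The [Moore (omit a j)] are the cofactors of the last row, so pairing them with another row gives
    an off-diagonal entry of matrix times adjugate. *)
Lemma sum_Moore_row a (r : nat) : (r < m.+1)%N ->
  \sum_(j < m.+1) a j ^+ (2 ^ r) * Moore (omit a j) = Moore a *+ (r == m).
Proof.
move=> ltr; pose i := Ordinal ltr.
have /matrixP /(_ i ord_max) := mul_mx_adj (Moore_mx a).
rewrite !mxE => e; rewrite -[(r == m)]/(i == ord_max) -e.
by apply: eq_bigr => j _; rewrite [X in _ = _ * X]mxE cofactor_Moore_last mxE.
Qed.

Lemma sum_Moore_sqr a :
  \sum_(j < m.+1) a j * Moore (omit a j) ^+ 2 = Moore a.
Proof.
rewrite -[RHS]/(\det (Moore_mx a)) (expand_det_row _ ord0).
by apply: eq_bigr => j _; rewrite cofactor_Moore_first mxE expr1.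
Qed.

End MooreRing.

Lemma Moore_map (R S : comNzRingType) (f : {rmorphism R -> S}) n (a : 'I_n -> R) :
  Moore (fun j => f (a j)) = f (Moore a).
Proof.
rewrite /Moore -det_map_mx; congr (\det _).
by apply/matrixP=> i j; rewrite !mxE rmorphXn.
Qed.

Lemma F2comb_map (U V : nmodType) (f : {additive U -> V}) n (a : 'I_n -> U) c :
  F2comb (fun j => f (a j)) c = f (F2comb a c).
Proof. by rewrite /F2comb raddf_sum; apply: eq_bigr => i _; rewrite raddfMn. Qed.

(** * Nonvanishing and factorisation over an integral domain *)

Section MooreDomain.
Variables (R : idomainType) (chR : 2%N \in [pchar R]).

Lemma eq_pow2 (i j : nat) : ((2 ^ i)%N == (2 ^ j)%N) = (i == j).
Proof. by rewrite eqn_exp2l. Qed.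

(** A vector in the left kernel gives a nonzero additive polynomial of degree at most 2^(n-1) that
    vanishes at every [a j], hence at all 2^n distinct combinations. *)
Lemma Moore_neq0 n (a : 'I_n -> R) :
  (forall c : 'rV['F_2]_n, c != 0 -> F2comb a c != 0) -> Moore a != 0.
Proof.
move=> a0; apply/det0P=> -[v v0 vM].
pose p := \sum_(i < n) v 0 i *: 'X^(2 ^ i) : {poly R}.
have /rV0Pn [i vi] := v0.
have p0 : p != 0.
  apply: contraNneq vi => /polyP /(_ (2 ^ i)%N).
  rewrite coef0 /p coef_sum (bigD1 i) //= big1 ?addr0 => [|j jNi].
    by rewrite coefZ coefXn eqxx mulr1 => ->.
  by rewrite coefZ coefXn eq_pow2 (inj_eq val_inj) eq_sym (negPf jNi) mulr0.
pose rs := [seq F2comb a c | c <- enum [set: 'rV['F_2]_n]].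
suff rts : all (root p) rs.
  have := max_poly_roots p0 rts.
  rewrite map_inj_uniq ?enum_uniq; last exact: F2comb_inj.
  rewrite size_map -cardE cardsT card_mx card_Fp // mul1n => /(_ isT).
  apply/negP; rewrite -leqNgt; apply: (leq_trans (size_sum _ _ _)).
  apply/bigmax_leqP=> j _; apply: (leq_trans (size_scale_leq _ _)).
  by rewrite size_polyXn ltn_exp2l.
apply/allP=> _ /mapP [c _ ->]; apply/rootP; rewrite horner_sum.
under eq_bigr => j _.
  rewrite hornerZ hornerXn F2combX2 // F2combE mulr_sumr; over.
rewrite exchange_big big1 //= => j _.
have /matrixP /(_ 0 j) := vM; rewrite !mxE => e.
transitivity ((c 0 j : nat)%:R * 0 : R); last by rewrite mulr0.
rewrite -[in RHS]e mulr_sumr; apply: eq_bigr => l _.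
by rewrite mxE mulrCA.
Qed.

Variable m : nat.

(* [p] interpolates [c |-> dot l c * Moore a] at the points [F2comb a c]; its
   degree is at most [2 ^ m], so its zeros are exactly those with [dot l c = 0]. *)
Lemma Moore_factor (a : 'I_m.+1 -> R) (l : 'rV['F_2]_m.+1) :
    (forall c : 'rV['F_2]_m.+1, c != 0 -> F2comb a c != 0) -> l != 0 ->
  Moore a = F2comb (fun j => Moore (omit a j)) l
            * \prod_(c | dot l c == 1) F2comb a c.
Proof.
move=> a0 l0; have [i0 li0] := rVF2_neq0 l0.
pose e (i : 'I_m.+1) := F2comb (cofactor (Moore_mx a) i) l.
pose p := \sum_(i < m.+1) e i *: 'X^(2 ^ i) : {poly R}.
have pE c : p.[F2comb a c] = Moore a *+ dot l c.
  rewrite horner_sum.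
  transitivity (\sum_(i < m.+1) \sum_(h < m.+1) \sum_(j < m.+1)
      (l 0 j : nat)%:R * (c 0 h : nat)%:R
        * (a h ^+ (2 ^ i) * cofactor (Moore_mx a) i j)).
    apply: eq_bigr => i _; rewrite hornerZ hornerXn F2combX2 // /e !F2combE.
    rewrite mulrC mulr_suml; apply: eq_bigr => h _; rewrite mulr_sumr.
    by apply: eq_bigr => j _; ring.
  rewrite exchange_big /=.
  transitivity (\sum_(h < m.+1) Moore a *+ (l 0 h * c 0 h)%R).
    apply: eq_bigr => h _; rewrite exchange_big (bigD1 h) //.
    rewrite -mulr_sumr sum_Moore_cofactor eqxx big1.
      rewrite [LHS]addr0.
      case: (F2_cases (l 0 h)) (F2_cases (c 0 h)) => -> [] ->;
        by rewrite !(mulr0, mul0r, mulr1, mul1r, mulr0n, mulr1n).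
    move=> j jNh; rewrite -mulr_sumr sum_Moore_cofactor eq_sym (negPf jNh).
    by rewrite mulr0.
  rewrite /dot; elim/big_rec2: _ => [//|h x y _ ->].
  by rewrite mulrn_F2D.
have eE : e ord_max = F2comb (fun j => Moore (omit a j)) l.
  by apply: eq_bigr => j _; rewrite cofactor_Moore_last.
(* [e ord_max] is the coefficient of [p] at 2^m. Subtracting that multiple of the monic product
   leaves degree below 2^m, while the 2^m points with [dot l c = 0] remain roots. *)
pose q := p - e ord_max *: \prod_(c | dot l c == 0) ('X - (F2comb a c)%:P).
have lc0 : dot l (delta_mx 0 i0) = 1 by rewrite dot_deltar.
have card0 : #|[pred c | dot l c == 0]| = (2 ^ m)%N.
  by rewrite (card_dot0 lc0) card_dot1.
have szprod : size (\prod_(c | dot l c == 0) ('X - (F2comb a c)%:P)) = (2 ^ m).+1.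
  rewrite -big_filter size_prod_XsubC -card0 cardE.
  by congr (size _).+1; rewrite enumT.
have q0 : q = 0.
  apply: (@roots_geq_poly_eq0 _ _ [seq F2comb a c | c <- enum [pred c | dot l c == 0]]).
  - apply/allP=> _ /mapP [c lc ->]; rewrite mem_enum inE in lc.
    rewrite /root hornerD hornerN hornerZ pE (eqP lc) mulr0n.
    by rewrite (bigD1 c) //= hornerM hornerXsubC subrr mul0r mulr0 subrr.
  - by rewrite map_inj_uniq ?enum_uniq //; apply: F2comb_inj.
  rewrite size_map -cardE card0; apply/leq_sizeP=> j; rewrite leq_eqVlt.
  have psz : (size p <= (2 ^ m).+1)%N.
    apply: (leq_trans (size_sum _ _ _)); apply/bigmax_leqP=> i _.
    apply: (leq_trans (size_scale_leq _ _)).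
    by rewrite size_polyXn ltnS leq_exp2l // -ltnS.
  case/orP=> [/eqP <-|ltj]; rewrite coefB coefZ; last first.
    by rewrite !(nth_default 0) ?szprod ?mulr0 ?subr0 //; apply: leq_trans psz _.
  have -> : (\prod_(c | dot l c == 0) ('X - (F2comb a c)%:P))`_(2 ^ m) = 1.
    have /monicP := monic_prod_XsubC (index_enum _) (fun c => dot l c == 0) (F2comb a).
    by rewrite /lead_coef szprod.
  rewrite /p coef_sum (bigD1 ord_max) //= big1 ?addr0 => [|i iNm].
    by rewrite coefZ coefXn eqxx subrr.
  rewrite coefZ coefXn eq_pow2 eq_sym.
  rewrite -[m in _ == m]/(val (ord_max : 'I_m.+1)) (inj_eq val_inj).
  by rewrite (negPf iNm) mulr0.
(* Evaluating at a vector where [l] is 1 gives [Moore a], and translation by this vector carries the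
   kernel of [l] to the other level set. *)
have := pE (delta_mx 0 i0); rewrite lc0 mulr1n => <-.
move/eqP: q0; rewrite subr_eq0 => /eqP ->.
rewrite hornerZ eE; congr (_ * _); rewrite horner_prod.
rewrite [RHS](reindex_inj (addrI (delta_mx 0 i0))) /=; apply: eq_big => c.
  by rewrite dotDr lc0; case: (F2_cases (dot l c)) => ->.
by move=> _; rewrite hornerXsubC F2combD // (oppr_pchar2 chR).
Qed.

End MooreDomain.

(** * The equation w' = w^2 for ratios of Moore determinants *)

Section Logarithmic.
Variables (K : fieldType) (chK : 2%N \in [pchar K]) (m : nat).
Variables (W V : 'I_m.+1 -> K) (D b : K).
Hypotheses (DE : Moore W = D) (VE : forall j, Moore (omit W j) = V j).
Let Q j := V j ^+ 4 / D ^+ 2 + b * V j ^+ 2.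
Let w j := Moore (omit Q j) / Moore Q.
Hypothesis W_indep : forall c : 'rV['F_2]_m.+1, c != 0 -> F2comb W c != 0.
Hypothesis Q_neq0 : Moore Q != 0.

Let D0 : D != 0. Proof. by rewrite -DE; apply: Moore_neq0 W_indep. Qed.
Let psi j := V j / D.
Let T s := \sum_j psi j ^+ (2 ^ s) * w j.

Let addKK (x : K) : x + x = 0. Proof. exact: addrr_pchar2. Qed.

Let eq_addr (x y z : K) : x + y = z -> x = z + y.
Proof. by move=> <-; rewrite -addrA addKK addr0. Qed.

Let psi_indep (c : 'rV['F_2]_m.+1) : c != 0 -> F2comb psi c != 0.
Proof.
move=> c0; have := Moore_factor chK W_indep c0; rewrite DE => e.
apply: contra_neq D0 => psi0; rewrite e.
suff -> : F2comb (fun j => Moore (omit W j)) c = F2comb psi c * D.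
  by rewrite psi0 !mul0r.
rewrite /F2comb mulr_suml; apply: eq_bigr => j _.
by rewrite mulrnAl /psi mulfVK // VE.
Qed.

(** The [psi j] form the last column of the inverse of the Moore matrix of [W]; the [w j] play the
    same role for [Q] in [Qw]. *)
Let psiW r : (r < m.+1)%N -> \sum_j psi j * W j ^+ (2 ^ r) = (r == m)%:R.
Proof.
move=> ltr; transitivity ((\sum_j W j ^+ (2 ^ r) * V j) / D).
  by rewrite mulr_suml; apply: eq_bigr => j _; rewrite /psi; ring.
under eq_bigr do rewrite -VE.
by rewrite (sum_Moore_row chK) // DE mulrnAl divff.
Qed.

Let psi2W : \sum_j psi j ^+ 2 * W j = D^-1.
Proof.
transitivity ((\sum_j W j * V j ^+ 2) / D ^+ 2).
  by rewrite mulr_suml; apply: eq_bigr => j _; rewrite /psi; field.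
under eq_bigr do rewrite -VE.
by rewrite (sum_Moore_sqr chK) DE; field.
Qed.

Let Qw r : (r < m.+1)%N -> \sum_j Q j ^+ (2 ^ r) * w j = (r == m)%:R.
Proof.
move=> ltr; transitivity ((\sum_j Q j ^+ (2 ^ r) * Moore (omit Q j)) / Moore Q).
  by rewrite mulr_suml; apply: eq_bigr => j _; rewrite mulrA.
by rewrite (sum_Moore_row chK) // mulrnAl divff.
Qed.

Let QX j r : Q j ^+ (2 ^ r) =
  D ^+ (2 ^ r.+1) * (psi j ^+ (2 ^ r.+2) + b ^+ (2 ^ r) * psi j ^+ (2 ^ r.+1)).
Proof.
have -> : Q j = D ^+ 2 * (psi j ^+ 4 + b * psi j ^+ 2) by rewrite /Q /psi; field.
have pn : [pchar K].-nat (2 ^ r)%N by rewrite pnatX pnatE // chK.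
rewrite [LHS]exprMn exprDn_pchar // [(b * _) ^+ _]exprMn -!exprM.
by rewrite !expnS !mulnA.
Qed.

(** Since [Q j] is an additive polynomial in [psi j], the duality [Qw] becomes a two-term recursion
    for the sums [T]. *)
Let T_rec r : (r < m.+1)%N ->
  D ^+ (2 ^ r.+1) * (T r.+2 + b ^+ (2 ^ r) * T r.+1) = (r == m)%:R.
Proof.
move=> ltr; rewrite -(Qw ltr) mulrDr !mulr_sumr -big_split.
by apply: eq_bigr => j _; rewrite QX /=; ring.
Qed.

(** Below the top row the recursion is homogeneous; the exponent is 1 + 2 + ... + 2^(s-1). *)
Let TE s : (s <= m)%N -> T s.+1 = b ^+ (2 ^ s - 1) * T 1.
Proof.
elim: s => [|s IH] les; first by rewrite mul1r.
have := T_rec (leqW les); rewrite (ltn_eqF les) => /eqP.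
rewrite mulf_eq0 expf_eq0 (negPf D0) andbF /= addr_eq0 (oppr_pchar2 chK).
move=> /eqP ->; rewrite IH 1?ltnW // mulrA -exprD; congr (_ ^+ _ * _).
by have := expn_gt0 2 s; rewrite expnS; lia.
Qed.

(* The minimal additive relation among the [psi j], normalised at its linear
   term; pairing it with the [W j ^+ (2 ^ m)] computes the leading coefficient. *)
Let psi_relation : exists2 B : 'I_m.+1 -> K,
  forall j, psi j = \sum_(t < m.+1) B t * psi j ^+ (2 ^ t.+1) &
  B ord_max = D ^+ (2 ^ m).
Proof.
(* The squares [psi j ^+ 2] are again independent, so their Moore matrix is invertible and the
   relation is found by solving a linear system. *)
pose M := Moore_mx (fun j => psi j ^+ 2).
have uM : M \in unitmx.
  rewrite unitmxE unitfE; apply: (Moore_neq0 chK) => c c0.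
  by rewrite -(F2combX2 chK psi c 1) expf_neq0 // psi_indep.
pose B := (\row_j psi j) *m invmx M.
have BE j : psi j = \sum_(t < m.+1) B 0 t * psi j ^+ (2 ^ t.+1).
  have e : (B *m M) 0 j = psi j by rewrite mulmxKV // mxE.
  rewrite -{1}e mxE; apply: eq_bigr => t _.
  by rewrite [M t j]mxE -exprM expnS.
exists (B 0) => //; apply: (mulIf (invr_neq0 (expf_neq0 (2 ^ m) D0))).
rewrite mulfV ?expf_neq0 //.
transitivity (\sum_j psi j * W j ^+ (2 ^ m)); last by rewrite psiW // eqxx.
transitivity (\sum_(t < m.+1) B 0 t * \sum_j psi j ^+ (2 ^ t.+1) * W j ^+ (2 ^ m)).
  (* Only the top index survives: there the inner sum is a Frobenius power of [psi2W], and for t < m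
     it is one of [psiW] at m - t - 1 < m, which is zero. *)
  rewrite big_ord_recr /= big1 ?add0r => [|t _].
    congr (_ * _); rewrite -exprVn -psi2W (sumrX2 chK).
    by apply: eq_bigr => j _; rewrite exprMn -exprM expnS.
  have ltm : (m - t.+1 < m.+1)%N by lia.
  have mtF : (m - t.+1 == m)%N = false by have := ltn_ord t; lia.
  transitivity (B 0 (widen_ord (leqnSn m) t) * 0); last by rewrite mulr0.
  congr (_ * _); transitivity ((\sum_j psi j * W j ^+ (2 ^ (m - t.+1))) ^+ (2 ^ t.+1)).
    rewrite (sumrX2 chK); apply: eq_bigr => j _.
    by rewrite [RHS]exprMn -[in RHS]exprM -expnD subnK.
  by rewrite psiW // mtF expr0n expn_eq0.
under eq_bigr do rewrite mulr_sumr.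
rewrite exchange_big; apply: eq_bigr => j _; rewrite [in RHS]BE mulr_suml.
by apply: eq_bigr => t _; rewrite [LHS]mulrA.
Qed.

(** Pairing [psi_relation] with [w] expresses [T 0] through [T 1]; pairing its square with [w] gives
    an affine equation for [T 1]. Multiplied by [T 1], the latter contains exactly b times the
    square of the former. *)
Let T_quadratic : T 1 ^+ 2 + b * T 0 ^+ 2 = T 1.
Proof.
have [B BE Bm] := psi_relation.
have e0 : T 0 = \sum_(t < m.+1) B t * (b ^+ (2 ^ t - 1) * T 1).
  transitivity (\sum_(t < m.+1) B t * T t.+1); last first.
    by apply: eq_bigr => t _; rewrite TE // -ltnS.
  under [RHS]eq_bigr do rewrite mulr_sumr.
  rewrite exchange_big; apply: eq_bigr => j _; rewrite expr1 {1}BE mulr_suml.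
  by apply: eq_bigr => t _; rewrite [RHS]mulrA.
have e1 : T 1 = \sum_(t < m.+1) B t ^+ 2 * T t.+2.
  under [RHS]eq_bigr do rewrite mulr_sumr.
  rewrite exchange_big; apply: eq_bigr => j _.
  rewrite {1}BE (sumrX2 chK) mulr_suml.
  by apply: eq_bigr => t _; rewrite [_ ^+ (2 ^ 1)]exprMn -exprM -expnSr [RHS]mulrA.
(* The constant 1 comes from the inhomogeneous top case of [T_rec], whose factor is the square of
   [B ord_max]. *)
have e2 : T 1 = 1 + \sum_(t < m.+1) B t ^+ 2 * (b ^+ (2 ^ t.+1 - 1) * T 1).
  rewrite {1}e1 !big_ord_recr /= addrCA; congr (_ + _).
    by apply: eq_bigr => t _; rewrite (TE (ltn_ord t)).
  have := T_rec (ltnSn m); rewrite eqxx mulrDr => /eq_addr.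
  rewrite Bm -exprM -expnSr => ->; congr (_ + _).
  rewrite TE // [b ^+ _ * (_ * _)]mulrA -exprD.
  by congr (_ * (_ ^+ _ * _)); have := expn_gt0 2 m; rewrite expnS; lia.
move/esym/eq_addr/(congr1 ( *%R^~ (T 1))): e2; rewrite /= mul1r mulrDl => e2.
rewrite [RHS]e2 e0; congr (_ + _).
rewrite -[X in _ * _ ^+ X]/(2 ^ 1)%N (sumrX2 chK) mulr_sumr mulr_suml.
apply: eq_bigr => t _.
have -> : (2 ^ t.+1 - 1 = ((2 ^ t - 1) * 2).+1)%N.
  by have := expn_gt0 2 t; rewrite expnS; lia.
by rewrite expn1 [b ^+ _.+1]exprS [b ^+ (_ * _)]exprM; ring.
Qed.

(** The defects [d (w j) + w j ^+ 2] are shown orthogonal to every row of the invertible Moore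
    matrix of [Q]. The row pairings with [d (w j)] come from differentiating [Qw]. *)
Lemma Moore_ratio_logarithmic (d : K -> K) :
    {morph d : x y / x + y} -> (forall x y, d (x * y) = d x * y + x * d y) ->
    (forall j, d (Q j) = V j ^+ 2) ->
  forall j, d (w j) = w j ^+ 2.
Proof.
move=> dD dM dQ.
have d0 : d 0 = 0 by have := dM 0 0; rewrite mulr0 mul0r mulr0 addr0.
have d1 : d 1 = 0 by have := dM 1 1; rewrite !mulr1 mul1r addKK.
have dsum (F : 'I_m.+1 -> K) : d (\sum_j F j) = \sum_j d (F j).
  exact: (big_morph d dD d0).
have dX r x : d (x ^+ (2 ^ r.+1)) = 0.
  by rewrite expnS mulnC exprM expr2 dM mulrC addKK.
pose e j := d (w j) + w j ^+ 2.
have QwD r : (r < m.+1)%N ->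
    \sum_j Q j ^+ (2 ^ r) * d (w j) = \sum_j d (Q j ^+ (2 ^ r)) * w j.
  move=> ltr; apply/eqP; rewrite -subr_eq0 (oppr_pchar2 chK) -big_split /=.
  have := congr1 d (Qw ltr); rewrite dsum.
  have -> : d (r == m)%:R = 0 by case: eqP.
  move=> de; apply/eqP; rewrite -[RHS]de; apply: eq_bigr => j _.
  by rewrite [RHS]dM [RHS]addrC.
have Qe r : (r < m.+1)%N -> \sum_j Q j ^+ (2 ^ r) * e j = 0.
  move=> ltr; under eq_bigr do rewrite mulrDr.
  (* For a positive row the derivative of the Frobenius power is zero and the rest is the square of
     [Qw] one row lower. Row 0 is [T_quadratic]. *)
  rewrite big_split QwD //; case: r ltr => [_|r ltr] /=; last first.
    rewrite big1 ?add0r => [|j _]; last by rewrite dX mul0r.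
    transitivity ((\sum_j Q j ^+ (2 ^ r) * w j) ^+ (2 ^ 1)).
      rewrite (sumrX2 chK); apply: eq_bigr => j _.
      by rewrite [RHS]exprMn -[in RHS]exprM -expnSr.
    by rewrite Qw ?(ltnW ltr) // (ltn_eqF (ltr : (r < m)%N)) expr0n.
  have -> : \sum_j d (Q j ^+ (2 ^ 0)) * w j = D ^+ 2 * T 1.
    rewrite mulr_sumr; apply: eq_bigr => j _.
    by rewrite expr1 dQ /psi; field.
  have -> : \sum_j Q j ^+ (2 ^ 0) * w j ^+ 2 = D ^+ 2 * (T 1 ^+ 2 + b * T 0 ^+ 2).
    rewrite [T 1 ^+ 2](sumrX2 chK _ _ _ 1) [T 0 ^+ 2](sumrX2 chK _ _ _ 1).
    rewrite mulrDr !mulr_sumr -big_split.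
    by apply: eq_bigr => j _; rewrite /= !expn1 !expn0 /Q /psi; field.
  by rewrite T_quadratic addKK.
move=> j.
apply/eqP; rewrite -subr_eq0 (oppr_pchar2 chK) -/(e j).
have uM : (Moore_mx Q) \in unitmx by rewrite unitmxE unitfE.
have Me : Moore_mx Q *m (\col_j e j) = 0.
  apply/colP=> r; rewrite !mxE -[RHS](Qe r) //.
  by apply: eq_bigr => l _; rewrite !mxE.
have := congr1 (mulmx (invmx (Moore_mx Q))) Me.
by rewrite mulKmx // mulmx0 => /colP /(_ j); rewrite !mxE => ->.
Qed.

End Logarithmic.

(** * Derivation and orders on k(X) *)

Lemma quotient_ruleD (K : fieldType) (x y z t x' y' z' t' : K) :
    y != 0 -> t != 0 ->
  ((x' * t + x * t' + (z' * y + z * y')) * (y * t)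
    - (x * t + z * y) * (y' * t + y * t')) / (y * t) ^+ 2
  = (x' * y - x * y') / y ^+ 2 + (z' * t - z * t') / t ^+ 2.
Proof. by move=> y0 t0; field; rewrite y0 t0. Qed.

Lemma quotient_ruleM (K : fieldType) (x y z t x' y' z' t' : K) :
    y != 0 -> t != 0 ->
  ((x' * z + x * z') * (y * t) - x * z * (y' * t + y * t')) / (y * t) ^+ 2
  = (x' * y - x * y') / y ^+ 2 * (z / t) + x / y * ((z' * t - z * t') / t ^+ 2).
Proof. by move=> y0 t0; field; rewrite y0 t0. Qed.

Section RationalFunctionsLemmas.
Variable k : fieldType.
Implicit Types (f g : {fraction {poly k}}) (p q U : {poly k}).

Lemma tofrac_neq0 p : p != 0 -> p%:F != 0 :> {fraction {poly k}}.
Proof. by rewrite tofrac_eq0. Qed.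

Lemma fderivD : {morph @fderiv k : f g / f + g}.
Proof.
move=> f g; have [f0 g0] := (fden_neq0 f, fden_neq0 g).
have [f0' g0'] := (tofrac_neq0 f0, tofrac_neq0 g0).
have -> : f + g = (fnum f * fden g + fnum g * fden f)%:F / (fden f * fden g)%:F.
  by rewrite tofracD !tofracM -(addf_div _ _ f0' g0') -!fracE.
rewrite fderivE ?mulf_neq0 // /fderiv !derivD !derivM.
rewrite !(tofracB, tofracD, tofracXn, tofracM).
exact (quotient_ruleD _ _ _ _ _ _ f0' g0').
Qed.

Lemma fderivM f g : fderiv (f * g) = fderiv f * g + f * fderiv g.
Proof.
have [f0 g0] := (fden_neq0 f, fden_neq0 g).
have [f0' g0'] := (tofrac_neq0 f0, tofrac_neq0 g0).
have -> : f * g = (fnum f * fnum g)%:F / (fden f * fden g)%:F.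
  by rewrite !tofracM -mulf_div -!fracE.
rewrite fderivE ?mulf_neq0 // /fderiv !derivM.
rewrite !(tofracB, tofracD, tofracXn, tofracM).
by rewrite (quotient_ruleM _ _ _ _ _ _ f0' g0') -!fracE.
Qed.

Lemma fderiv_tofrac p : fderiv p%:F = (p^`())%:F.
Proof.
have := @fderivE _ p 1 (oner_neq0 _).
by rewrite rmorph1 divr1 => ->; rewrite derivC mulr0 subr0 mulr1 expr1n rmorph1 divr1.
Qed.

Lemma psubVX_reverse p :
  psubVX p * 'X%:F ^+ (size p).-1 = (\poly_(i < size p) p`_(size p - i.+1))%:F.
Proof.
have X0 : 'X%:F != 0 :> {fraction {poly k}} by rewrite tofrac_eq0 polyX_eq0.
rewrite /psubVX (@horner_coef_wide _ (size p)) ?size_poly // poly_def rmorph_sum.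
rewrite mulr_suml (reindex_inj rev_ord_inj) /=; apply: eq_bigr => i _.
rewrite coef_map_id0 ?rmorph0 // -mul_polyC rmorphM rmorphXn /= -mulrA.
congr (_ * _); rewrite exprVn; apply: (canLR (mulKf (expf_neq0 _ X0))).
by rewrite -exprD; congr (_ ^+ _); have := ltn_ord i; lia.
Qed.

(** Under X -> 1/X, the inverse of U becomes X^(deg U) over the reciprocal polynomial, whose value
    at 0 is the leading coefficient of U. *)
Lemma form_ord_inftyV U : U != 0 ->
  form_ord_infty (U%:F^-1) = ((size U).-1)%:Z - 2.
Proof.
move=> U0; rewrite /form_ord_infty; congr (_ - _).
have X0 : 'X%:F != 0 :> {fraction {poly k}} by rewrite tofrac_eq0 polyX_eq0.
pose r := \poly_(i < size U) U`_(size U - i.+1).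
have r0 : r.[0] != 0.
  by rewrite horner_coef0 coef_poly size_poly_gt0 U0 subn1 -lead_coefE lead_coef_eq0.
have rN0 : r != 0 by apply: contraNneq r0 => ->; rewrite horner0.
have -> : U%:F^-1 = 1%:F / U%:F by rewrite rmorph1 mul1r.
rewrite fsubVXE //.
have -> : psubVX (1 : {poly k}) = 1.
  by rewrite /psubVX (rmorph1 (map_poly (@FracField.tofrac {poly k} \o polyC))) hornerC.
have -> : 1 / psubVX U = ('X ^+ (size U).-1)%:F / r%:F.
  by rewrite -psubVX_reverse tofracXn invfM mulrCA divff ?expf_neq0 // mulr1 mul1r.
rewrite fordE ?expf_neq0 ?polyX_eq0 // (mupNroot r0) subr0.
by have := mup_XsubCX (size U).-1 (0 : k) 0; rewrite subr0 eqxx => ->.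
Qed.

Lemma ford_inv_le0 a U : U != 0 -> (ford a (U%:F^-1) <= 0)%R.
Proof.
move=> U0; have -> : U%:F^-1 = 1%:F / U%:F by rewrite rmorph1 mul1r.
rewrite fordE ?oner_neq0 // mupNroot ?root1 // sub0r.
by rewrite Num.Theory.oppr_le0.
Qed.

End RationalFunctionsLemmas.

(** * Degrees, coprime products and Chinese remainders *)

Section Polynomials.
Variable k : fieldType.
Implicit Types (p q : {poly k}).

Lemma size_poly_sqr p : size (p ^+ 2) = ((2 * size p).-1)%N.
Proof.
have [->|p0] := eqVneq p 0; first by rewrite expr0n size_poly0.
have p2 : (0 < size (p ^+ 2))%N by rewrite size_poly_gt0 expf_neq0.
move: p0; rewrite -(prednK p2) size_exp -size_poly_gt0.
by case: (size p) => // s _; lia.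
Qed.

(** No cancellation of leading terms: the second summand has odd degree, and the first, if nonzero,
    even degree. *)
Lemma size_sqr_addX_sqr p q : q != 0 ->
  size (p ^+ 2 + 'X * q ^+ 2) = maxn (2 * size p).-1 (2 * size q).
Proof.
move=> q0.
have q_gt0 : (0 < size q)%N by rewrite size_poly_gt0.
have szq : size ('X * q ^+ 2) = (2 * size q)%N.
  rewrite mulrC size_mulX ?expf_neq0 // size_poly_sqr.
  by lia.
case: (ltngtP (size (p ^+ 2)) (size ('X * q ^+ 2))) => [lt|lt|].
- by rewrite addrC size_polyDl // szq; move: lt; rewrite size_poly_sqr szq; lia.
- by rewrite size_polyDl // size_poly_sqr; move: lt; rewrite size_poly_sqr szq; lia.
by rewrite size_poly_sqr szq; lia.
Qed.

Lemma coprimep_prodr (I : eqType) (r : seq I) (P : pred I) (F : I -> {poly k}) p :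
  (forall i, P i -> coprimep p (F i)) -> coprimep p (\prod_(i <- r | P i) F i).
Proof.
move=> pF; elim/big_rec: _ => [|i q Pi pq]; first exact: coprimep1.
by rewrite coprimepMr pF.
Qed.

Lemma dvdp_prod_coprime (I : eqType) (r : seq I) (P : pred I) (F : I -> {poly k}) p :
    uniq r -> (forall i j, P i -> P j -> i != j -> coprimep (F i) (F j)) ->
  (forall i, P i -> F i %| p) -> \prod_(i <- r | P i) F i %| p.
Proof.
move=> + coF dvF; elim: r => [|i r IH] /=; first by rewrite big_nil dvd1p.
case/andP=> ir /IH {}IH; rewrite big_cons; case: ifP => // Pi.
rewrite Gauss_dvdp ?dvF //= big_seq_cond; apply: coprimep_prodr => j /andP [jr Pj].
by apply: coF => //; apply: contraNneq ir => ->.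
Qed.

Lemma chinese_poly (I : finType) (P : pred I) (F g : I -> {poly k}) :
    (forall i j, P i -> P j -> i != j -> coprimep (F i) (F j)) ->
  exists p, forall i, P i -> F i %| p - g i.
Proof.
move=> coF.
pose M i := \prod_(j | P j && (j != i)) F j.
have [u uM] : exists u : I -> {poly k}, forall i, P i -> F i %| u i * M i - 1.
  have coM i : P i -> coprimep (F i) (M i).
    move=> Pi; apply: coprimep_prodr => j /andP [Pj ji].
    by apply: coF => //; rewrite eq_sym.
  have exu i : exists u, P i ==> (F i %| u * M i - 1).
    have [Pi|] := boolP (P i); last by exists 0.
    have [[v u'] /= e] := Bezout_eq1_coprimepP _ _ (coM i Pi).
    exists u'; rewrite -e opprD addrCA subrr addr0 dvdpNr.
    exact: dvdp_mull.
  exists (fun i => xchoose (exu i)) => i Pi.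
  by have /implyP := xchooseP (exu i); apply.
(* [u i * M i] is 1 modulo [F i] and 0 modulo every other [F j]. *)
exists (\sum_(i | P i) g i * (u i * M i)) => i Pi.
rewrite (bigD1 i) //= addrAC dvdp_add //.
  have -> : g i * (u i * M i) - g i = g i * (u i * M i - 1) by ring.
  by rewrite dvdp_mull // uM.
elim/big_ind: _ => [|x y|j /andP [Pj ji]]; first exact: dvdp0.
  exact: dvdp_add.
rewrite !dvdp_mull // /M (bigD1 i) ?dvdp_mulr //=.
by rewrite Pi eq_sym.
Qed.

End Polynomials.

(** * Identities for the Q_i *)

Lemma F2comb_quartic (R : comNzRingType) (chR : 2%N \in [pchar R]) n
    (a : 'I_n -> R) (u v : R) c :
  F2comb (fun j => a j ^+ 4 * u + v * a j ^+ 2) c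
  = F2comb a c ^+ 4 * u + v * F2comb a c ^+ 2.
Proof.
rewrite (F2combX2 chR a c 2) (F2combX2 chR a c 1) mulr_suml mulr_sumr.
rewrite -big_split; apply: eq_bigr => j _ /=.
by rewrite mulrnDl mulrnAl mulrnAr.
Qed.

Lemma F2comb_omit (V : nmodType) m (a : 'I_m.+1 -> V) i (c : 'rV['F_2]_m) :
  exists c' : 'rV['F_2]_m.+1,
    [/\ c' 0 i = 0, (c' == 0) = (c == 0) & F2comb (omit a i) c = F2comb a c'].
Proof.
pose c' := \row_j (if unlift i j is Some h then c 0 h else 0) : 'rV['F_2]_m.+1.
have c'l h : c' 0 (lift i h) = c 0 h by rewrite mxE liftK.
have c'i : c' 0 i = 0 by rewrite mxE unlift_none.
exists c'; split=> //.
  apply/eqP/eqP => [/rowP e|e]; apply/rowP => h.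
    by have := e (lift i h); rewrite c'l !mxE.
  by rewrite !mxE; case: unliftP => // j _; rewrite e mxE.
rewrite /F2comb (@bigD1_ord _ _ _ _ i) //= c'i mulr0n add0r.
by apply: eq_bigr => h _; rewrite c'l.
Qed.

Lemma size_prod_dot1 (k : fieldType) m (F : 'rV['F_2]_m.+1 -> {poly k}) l s :
    l != 0 -> (forall c, c != 0 -> size (F c) = s.+1) ->
  size (\prod_(c | dot l c == 1) F c) = (2 ^ m * s).+1.
Proof.
move=> l0 szF; have c_neq0 c : dot l c == 1 -> c != 0.
  by apply: contraTneq => ->; rewrite dot0r.
rewrite size_prod => [|c /c_neq0 /szF Fc]; last by rewrite -size_poly_gt0 Fc.
rewrite (eq_bigr (fun=> s.+1)) => [|c /c_neq0 /szF //].
by rewrite sum_nat_const (card_dot1 l0) /=; lia.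
Qed.

(** With D = v u, the terms without x add up to the square of (v + p) / u, so divisibility of v + p
    by u is what makes Q a polynomial. *)
Lemma quartic_quotient (K : fieldType) (chK : 2%N \in [pchar K]) (u v p h x : K) :
    u != 0 -> v != 0 -> v + p = h * u ->
  v ^+ 4 / (v * u) ^+ 2 + (x + (p / (v * u)) ^+ 2) * v ^+ 2 = h ^+ 2 + x * v ^+ 2.
Proof.
move=> u0 v0 e; have -> : p = h * u + v.
  by rewrite -e addrC addrA (addrr_pchar2 chK) add0r.
(* The two sides differ by twice this quantity. *)
rewrite -[RHS]addr0 -(addrr_pchar2 chK (h * v / u + v ^+ 2 / u ^+ 2)).
by field; rewrite u0 v0.
Qed.

Lemma quartic_clear_denom (K : fieldType) (chK : 2%N \in [pchar K]) (t v p x : K) :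
    t != 0 ->
  t ^+ 2 * (v ^+ 4 / t ^+ 2 + (x + (p / t) ^+ 2) * v ^+ 2)
  = (v * (v + p)) ^+ 2 + x * (v * t) ^+ 2.
Proof.
move=> t0; rewrite -[LHS]addr0 -(addrr_pchar2 chK (v ^+ 3 * p)).
by field.
Qed.

(** Compares the Q_i of two candidates x and y for alpha. *)
Lemma sqr_sub_pchar2 (K : comNzRingType) (chK : 2%N \in [pchar K]) (x y v t z : K) :
  ((y - x) * v) ^+ 2 = (t + (z + y ^+ 2) * v ^+ 2) - (t + (z + x ^+ 2) * v ^+ 2).
Proof.
rewrite -[RHS]addr0 -(addrr_pchar2 chK ((x ^+ 2 - x * y) * v ^+ 2)).
by ring.
Qed.

Lemma frac_coprime (k : fieldType) (f : {fraction {poly k}}) :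
  exists a b : {poly k}, [/\ b != 0, coprimep a b & f = a%:F / b%:F].
Proof.
have b0 := fden_neq0 f; set r := gcdp (fnum f) (fden f).
have r0 : r != 0 by rewrite gcdp_eq0 negb_and b0 orbT.
exists (fnum f %/ r), (fden f %/ r); split.
- by rewrite dvdp_div_eq0 ?dvdp_gcdr.
- by apply: coprimep_div_gcd; rewrite b0 orbT.
rewrite {1}(fracE f) -{1}(divpK (dvdp_gcdl (fnum f) (fden f))).
rewrite -{3}(divpK (dvdp_gcdr (fnum f) (fden f))) !tofracM -mulf_div.
by rewrite divff ?mulr1 // tofrac_eq0.
Qed.

(** Squares have zero derivative, so only X v^2 contributes. *)
Lemma fderiv_quartic (k : fieldType) (chF : 2%N \in [pchar {fraction {poly k}}])
    (t v q : {fraction {poly k}}) :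
  fderiv (v ^+ 4 / t ^+ 2 + ('X%:F + q ^+ 2) * v ^+ 2) = v ^+ 2.
Proof.
have d_sqr (f : {fraction {poly k}}) : fderiv (f ^+ 2) = 0.
  by rewrite expr2 fderivM mulrC (addrr_pchar2 chF).
rewrite -[4%N]/(2 * 2)%N exprM -expr_div_n mulrDl -exprMn !fderivD !d_sqr add0r addr0.
by rewrite fderivM d_sqr mulr0 addr0 fderiv_tofrac derivX tofrac1 mul1r.
Qed.

(** * Solving condition (i) *)

Section Construction.
Variables (k : closedFieldType) (chark : 2%N \in [pchar k]) (m d : nat).
Variable W : 'I_m.+1 -> {poly k}.
Hypothesis W_coprime : forall c c' : 'rV['F_2]_m.+1, c != 0 -> c' != 0 -> c != c' ->
  coprimep (F2comb W c) (F2comb W c').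
Hypothesis W_degree : forall c : 'rV['F_2]_m.+1, c != 0 -> size (F2comb W c) = d.+1.

Let chP : 2%N \in [pchar {poly k}].
Proof. exact: (rmorph_pchar (@polyC k) chark). Qed.

Let chF : 2%N \in [pchar {fraction {poly k}}].
Proof. exact: (rmorph_pchar (@FracField.tofrac {poly k}) chP). Qed.

Let W_neq0 (c : 'rV['F_2]_m.+1) : c != 0 -> F2comb W c != 0.
Proof. by move=> c0; rewrite -size_poly_gt0 W_degree. Qed.

Let D := Moore W.
Let D0 : D != 0. Proof. exact: Moore_neq0 W_neq0. Qed.
Let Vl := F2comb (Vpol W).
Let Ul (l : 'rV['F_2]_m.+1) := \prod_(c | dot l c == 1) F2comb W c.

Let DE l : l != 0 -> D = Vl l * Ul l.
Proof. by move=> l0; apply: Moore_factor. Qed.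

Let Vl_neq0 l : l != 0 -> Vl l != 0.
Proof. by move=> /DE e; apply: contra_neq D0 => Vl0; rewrite e Vl0 mul0r. Qed.

Let size_Vl l : l != 0 -> size D = (size (Vl l) + 2 ^ m * d)%N.
Proof.
move=> l0; have e := DE l0; rewrite e size_mul ?Vl_neq0 //.
  by rewrite (size_prod_dot1 l0 W_degree) addnS.
by rewrite -size_poly_gt0 (size_prod_dot1 l0 W_degree).
Qed.

(** By coprimality at most one nonzero combination W_w vanishes at x. Choosing i with w_i = 1
    excludes it from the span of the remaining W_j, whose values at x are then independent. *)
Lemma Vpol_no_common_root x : exists i, (Vpol W i).[x] != 0.
Proof.
have [i iP] : exists i : 'I_m.+1, forall c : 'rV['F_2]_m.+1,
    c != 0 -> c 0 i = 0 -> ~~ root (F2comb W c) x.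
  have [/existsP [w /andP [w0 wx]]|] :=
    boolP [exists w : 'rV['F_2]_m.+1, (w != 0) && root (F2comb W w) x].
    have [i wi] := rVF2_neq0 w0; exists i => c c0 ci.
    apply: coprimep_root wx; apply: W_coprime => //.
    by apply: contra_eq_neq ci => <-; rewrite wi.
  rewrite negb_exists => /forallP nw; exists ord0 => c c0 _.
  by have := nw c; rewrite c0.
exists i; rewrite -[_.[x]]/(horner_eval x _) -Moore_map; apply: Moore_neq0 => // c c0.
rewrite (F2comb_map (horner_eval x)).
have [c' [c'i c'0 ->]] := F2comb_omit W i c.
by apply: iP => //; rewrite c'0.
Qed.

(** W_w divides D by the factorisation along a coordinate form, and it is coprime to [Ul l] because
    w is not among the indices of that product. *)
Let dvd_Vl (w l : 'rV['F_2]_m.+1) : w != 0 -> l != 0 -> dot l w = 0 ->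
  F2comb W w %| Vl l.
Proof.
move=> w0 l0 lw; have [i wi] := rVF2_neq0 w0.
have dl : delta_mx 0 i != 0 :> 'rV['F_2]_m.+1.
  apply: contra_eq_neq wi => e; rewrite -dot_deltal e /dot big1 // => j _.
  by rewrite mxE mul0r.
have : F2comb W w %| D.
  by rewrite (DE dl) dvdp_mull // /Ul (bigD1 w) ?dot_deltal ?wi //= dvdp_mulr.
rewrite (DE l0) mulrC Gauss_dvdpr //; apply: coprimep_prodr => c lc.
by apply: W_coprime => //; [apply: contraTneq lc => -> | apply: contraTneq lc => <-];
  rewrite ?dot0r ?lw.
Qed.

Lemma exists_numerator : exists P : {poly k}, forall l, l != 0 -> Ul l %| Vl l + P.
Proof.
have exl (w : 'rV['F_2]_m.+1) : exists l : 'rV['F_2]_m.+1, (w != 0) ==> (dot l w == 1).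
  have [->|w0] := eqVneq w 0; first by exists 0.
  by have [i wi] := rVF2_neq0 w0; exists (delta_mx 0 i); rewrite dot_deltal wi.
(* The choice of a form with value 1 at w is harmless: two choices differ by a form vanishing at w,
   so [dvd_Vl] makes their [Vl] congruent modulo W_w. *)
pose lw w := xchoose (exl w).
have lwP w : w != 0 -> dot (lw w) w = 1.
  by move=> w0; have /implyP /(_ w0) /eqP := xchooseP (exl w).
have [P PP] := @chinese_poly k _ (fun w => w != 0) (F2comb W)
  (fun w => Vl (lw w)) W_coprime.
exists P => l l0; have c_neq0 c : dot l c == 1 -> c != 0.
  by apply: contraTneq => ->; rewrite dot0r.
apply: dvdp_prod_coprime => [|c c' /c_neq0 + /c_neq0|c lc].
- exact: index_enum_uniq.
- exact: W_coprime.
have c0 := c_neq0 _ lc.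
have -> : Vl l + P = (P - Vl (lw c)) + Vl (l + lw c).
  by rewrite /Vl F2combD //; ring.
rewrite dvdp_add ?PP //.
have [->|ll] := eqVneq (l + lw c) 0; first by rewrite /Vl F2comb0 dvdp0.
by apply: dvd_Vl => //; rewrite dotDl (eqP lc) lwP //; apply: val_inj.
Qed.

Lemma Q_polynomial_exists : exists P : {poly k}, Q_polynomial W (P%:F / D%:F).
Proof.
have [P PP] := exists_numerator; exists P => i.
have dl : delta_mx 0 i != 0 :> 'rV['F_2]_m.+1.
  by apply/eqP => /rowP /(_ i); rewrite !mxE !eqxx => /eqP.
have Ui : (Ul (delta_mx 0 i))%:F != 0 :> {fraction {poly k}}.
  by rewrite tofrac_eq0; apply: contra_neq D0 => e; rewrite (DE dl) e mulr0.
have Vi : (Vpol W i)%:F != 0 :> {fraction {poly k}}.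
  by rewrite tofrac_eq0 -(F2comb_delta (Vpol W) i) Vl_neq0.
have := PP _ dl; rewrite /Vl F2comb_delta => /dvdpP [h hE].
exists (h ^+ 2 + 'X * Vpol W i ^+ 2).
rewrite /Qrat -/D (DE dl) /Vl F2comb_delta.
have /(congr1 (@FracField.tofrac {poly k})) := hE; rewrite tofracD tofracM => e.
rewrite [RHS]tofracD (tofracXn 2 h) [('X * _)%:F]tofracM (tofracXn 2 (Vpol W i)).
rewrite [(_ * Ul _)%:F]tofracM.
exact: (quartic_quotient chF _ Ui Vi e).
Qed.

(** * From condition (i) to condition (ii) *)

Section FixedNumerator.
Variables (P : {poly k}) (q : 'I_m.+1 -> {poly k}).
Let alpha := P%:F / D%:F.
Hypothesis qE : forall i, Qrat W alpha i = (q i)%:F.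

Let Q_comb (c : 'rV['F_2]_m.+1) : F2comb (Qrat W alpha) c = (F2comb q c)%:F.
Proof.
rewrite -(F2comb_map (@FracField.tofrac {poly k})).
by apply: eq_bigr => i _; rewrite qE.
Qed.

Let q_clear (c : 'rV['F_2]_m.+1) :
  D ^+ 2 * F2comb q c = (Vl c * (Vl c + P)) ^+ 2 + 'X * (Vl c * D) ^+ 2.
Proof.
apply/eqP; rewrite -tofrac_eq; apply/eqP.
rewrite tofracD !(tofracXn 2, tofracM) tofracD -Q_comb F2comb_quartic //.
rewrite (F2comb_map (@FracField.tofrac {poly k})) -/Vl.
by apply: quartic_clear_denom => //; rewrite tofrac_eq0.
Qed.

Let size_q (c c' : 'rV['F_2]_m.+1) : c != 0 -> c' != 0 ->
  size (F2comb q c) = size (F2comb q c') /\ (1 < size (F2comb q c))%N.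
Proof.
(* [size D - 2 ^ m * d] is the common size of all [Vl c1], so the right-hand side does not depend on
   [c1]. *)
suff sz (c1 : 'rV['F_2]_m.+1) : c1 != 0 ->
    (size (F2comb q c1) + (2 * size D).-1).-1 =
      maxn (2 * (size D - 2 ^ m * d + size P).-1).-1
           (2 * (size D - 2 ^ m * d + size D).-1)
    /\ (0 < size D - 2 ^ m * d)%N.
  move=> c0 c'0; have [[e v0] [e' _]] := (sz _ c0, sz _ c'0).
  move: e e' v0.
  move: (size (F2comb q c)) (size (F2comb q c')) (size D) (size P) (2 ^ m * d)%N.
  by move=> s s' t p v; lia.
move=> c0; have szV := size_Vl c0.
have V0 := Vl_neq0 c0.
have VD0 : Vl c1 * D != 0 by rewrite mulf_neq0.
have := congr1 (fun p : {poly k} => size p) (q_clear c1).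
rewrite /= size_sqr_addX_sqr // (size_mul V0 D0) => e.
have q0 : F2comb q c1 != 0.
  apply: contra_eq_neq e => ->; rewrite mulr0 size_poly0.
  move: V0 D0; rewrite -!size_poly_gt0; move: (size D) (size (Vl c1)) => t v.
  by move: (size _) => s; lia.
move: e; rewrite size_mul ?expf_neq0 // size_poly_sqr addnC => ->; rewrite szV addnK.
split; last by rewrite size_poly_gt0.
(* If P is no larger than V, cancellation in V + P is possible, but the term in V D dominates
   anyway. Otherwise V + P has the size of P. *)
have [leP|ltP] := leqP (size P) (size (Vl c1)).
  have := size_polyD (Vl c1) P; have := size_polyMleq (Vl c1) (Vl c1 + P).
  move: V0 leP; rewrite -size_poly_gt0.
  move: (size (Vl c1)) (size P) (size (Vl c1 + P)) (size (Vl c1 * _)) (2 ^ m * d)%N.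
  by move=> v p s s' t; lia.
have szVP : size (Vl c1 + P) = size P by rewrite addrC size_polyDl.
rewrite size_mul ?szVP // -size_poly_gt0 szVP.
exact: leq_trans ltP.
Qed.

Let Q_indep (c : 'rV['F_2]_m.+1) : c != 0 -> F2comb (Qrat W alpha) c != 0.
Proof.
move=> c0; rewrite Q_comb tofrac_eq0 -size_poly_gt0.
by have [_ /ltnW] := size_q c0 c0.
Qed.

Let omega_comb (l : 'rV['F_2]_m.+1) : l != 0 ->
  F2comb (omega W alpha) l = ((\prod_(c | dot l c == 1) F2comb q c)%:F)^-1.
Proof.
move=> l0; have Q0 := Moore_neq0 chF Q_indep.
have e := Moore_factor chF Q_indep l0.
have -> : (\prod_(c | dot l c == 1) F2comb q c)%:F =
    \prod_(c | dot l c == 1) F2comb (Qrat W alpha) c.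
  by rewrite rmorph_prod; apply: eq_bigr => c _; rewrite Q_comb.
move: e Q0; set M := Moore _; set p := \prod_(c | _) _; set N := F2comb _ l => e M0.
have p0 : p != 0 by apply: contra_neq M0 => p0; rewrite e p0 mulr0.
apply: (mulIf p0); rewrite mulVf //; apply: (mulIf M0); rewrite mul1r [RHS]e.
rewrite mulrAC; congr (_ * _); rewrite mulr_suml; apply: eq_bigr => i _.
by rewrite mulrnAl /omega (sign_pchar2 chF) mul1r (mulfVK M0).
Qed.

Let fderiv_omega i : fderiv (omega W alpha i) = omega W alpha i ^+ 2.
Proof.
rewrite /omega (sign_pchar2 chF) mul1r.
have WE c : F2comb (fun j => (W j)%:F) c = (F2comb W c)%:F :> {fraction {poly k}}.
  exact: (F2comb_map (@FracField.tofrac {poly k})).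
apply: (@Moore_ratio_logarithmic _ chF _ (fun j => (W j)%:F)
          (fun j => (Vpol W j)%:F) D%:F ('X%:F + alpha ^+ 2)).
- exact: (Moore_map (@FracField.tofrac {poly k})).
- by move=> j; apply: (Moore_map (@FracField.tofrac {poly k})).
- by move=> c c0; rewrite WE tofrac_eq0 W_neq0.
- exact: (Moore_neq0 chF Q_indep).
- exact: fderivD.
- exact: fderivM.
by move=> j; apply: fderiv_quartic.
Qed.

Let fderiv_omega_comb (l : 'rV['F_2]_m.+1) :
  fderiv (F2comb (omega W alpha) l) = F2comb (omega W alpha) l ^+ 2.
Proof.
have d0 : fderiv (0 : {fraction {poly k}}) = 0 by rewrite -tofrac0 fderiv_tofrac deriv0.
rewrite (F2combX2 chF _ _ 1) /F2comb (big_morph _ (@fderivD k) d0).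
apply: eq_bigr => i _; case: (F2_cases (l 0 i)) => ->; first by rewrite !mulr0n.
by rewrite !mulr1n fderiv_omega.
Qed.

Lemma omega_Lspace_of_numerator (m_gt0 : (0 < m)%N) : omega_spans_Lspace W alpha.
Proof.
have dl : delta_mx 0 ord0 != 0 :> 'rV['F_2]_m.+1.
  by apply/eqP => /rowP /(_ ord0); rewrite !mxE !eqxx => /eqP.
pose s := (size (F2comb q (delta_mx 0 ord0))).-1.
have [_ s_gt1] := size_q dl dl.
have szq (c : 'rV['F_2]_m.+1) : c != 0 -> size (F2comb q c) = s.+1.
  by move=> c0; have [-> _] := size_q c0 dl; rewrite prednK // ltnW.
have s_gt0 : (0 < s)%N by rewrite -ltnS prednK // ltnW.
have U_size (l : 'rV['F_2]_m.+1) : l != 0 ->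
    size (\prod_(c | dot l c == 1) F2comb q c) = (2 ^ m * s).+1.
  by move=> l0; apply: size_prod_dot1.
have U_neq0 (l : 'rV['F_2]_m.+1) : l != 0 -> \prod_(c | dot l c == 1) F2comb q c != 0.
  by move=> l0; rewrite -size_poly_gt0 U_size.
(* Here lambda is the common degree of the combinations of [q]. The denominators have degree 2^m s,
   so the order at infinity is 2^m s - 2. *)
exists s, (fun x => exists c : 'rV['F_2]_m.+1, x = F2comb (omega W alpha) c).
have basis : F2basis (omega W alpha)
    (fun x => exists c : 'rV['F_2]_m.+1, x = F2comb (omega W alpha) c).
  split=> // c; apply: contra_eq => c0; rewrite omega_comb //.
  by rewrite invr_eq0 tofrac_eq0 U_neq0.
split=> //; exists (2 ^ m * s).-1%N; split=> //.
- by rewrite prednK // muln_gt0 expn_gt0.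
- rewrite -ltnS prednK ?muln_gt0 ?expn_gt0 //.
  apply: leq_trans (leq_pmulr _ s_gt0).
  by have := ltn_exp2l 0 m (isT : 1 < 2)%N; rewrite expn0 m_gt0.
- by exists (omega W alpha).
move=> _ [l ->] f0; have l0 : l != 0.
  by apply: contra_neq f0 => ->; rewrite F2comb0.
split.
(* From f' = f^2 one gets f = f' / f, so f is its own witness F. *)
- exists (F2comb (omega W alpha) l); split=> //.
  by rewrite fderiv_omega_comb expr2 mulfK.
- by move=> a; rewrite omega_comb // ford_inv_le0 // U_neq0.
rewrite omega_comb // form_ord_inftyV ?U_neq0 // U_size //=.
have : (0 < 2 ^ m * s)%N by rewrite muln_gt0 expn_gt0.
by move: (2 ^ m * s)%N => t; lia.
Qed.
End FixedNumerator.

(** The square of (beta - alpha) V_i is a polynomial for each i. At a root of the reduced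
    denominator, a V_i that does not vanish there would force the numerator to vanish too. *)
Lemma Q_polynomial_diff (alpha beta : {fraction {poly k}}) :
    Q_polynomial W alpha -> Q_polynomial W beta ->
  exists R : {poly k}, beta = alpha + R%:F.
Proof.
move=> Qa Qb; pose g := beta - alpha.
have gV i : exists h : {poly k}, (g * (Vpol W i)%:F) ^+ 2 = h%:F.
  have [[p pE] [p' p'E]] := (Qa i, Qb i); exists (p' - p).
  by rewrite tofracB -pE -p'E /Qrat; apply: sqr_sub_pchar2.
have [a [b [b0 ab gE]]] := frac_coprime g.
have bF : b%:F != 0 :> {fraction {poly k}} by rewrite tofrac_eq0.
have aV i : exists h : {poly k}, (a * Vpol W i) ^+ 2 = h * b ^+ 2.
  have [h hE] := gV i; exists h; apply/eqP; rewrite -tofrac_eq; apply/eqP.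
  rewrite [RHS]tofracM !tofracXn tofracM -hE gE -exprMn; congr (_ ^+ 2).
  by rewrite mulrAC mulfVK.
have /size_poly1P [u u0 bE] : size b == 1%N.
  apply: contraT => /closed_rootP [x bx]; have [i Vi] := Vpol_no_common_root x.
  have [h /(congr1 (horner^~ x))] := aV i.
  rewrite /= [RHS]hornerM !horner_exp hornerM (rootP bx) expr0n mulr0 => /eqP.
  rewrite expf_eq0 mulf_eq0 (negPf Vi) orbF /= => ax.
  by have := coprimep_root ab ax; rewrite (rootP bx) eqxx.
exists (a * u^-1%:P); rewrite -[LHS](subrK alpha) addrC; congr (_ + _).
rewrite -/g gE bE tofracM; congr (_ * _).
apply: (mulIf (_ : (u%:P)%:F != 0)); first by rewrite tofrac_eq0 polyC_eq0.
by rewrite mulVf ?tofrac_eq0 ?polyC_eq0 // -tofracM -polyCM mulVf // tofrac1.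
Qed.

End Construction.

(** * Existence and classification of alpha *)

Theorem theorem4p17 (k : closedFieldType) (chark : 2%N \in [pchar k])
    (n : nat) (n_ge3 : (3 <= n)%N) (d : nat) (W : 'I_n -> {poly k})
    (W_coprime : forall c c' : 'rV['F_2]_n, c != 0 -> c' != 0 -> c != c' ->
       coprimep (F2comb W c) (F2comb W c'))
    (W_degree : forall c : 'rV['F_2]_n, c != 0 -> size (F2comb W c) = d.+1) :
  let admissible (alpha : {fraction {poly k}}) :=
    (exists P : {poly k}, alpha = P%:F / (Moore W)%:F) /\
    Q_polynomial W alpha /\ omega_spans_Lspace W alpha in
  (exists alpha : {fraction {poly k}}, admissible alpha) /\
  (forall alpha : {fraction {poly k}}, admissible alpha ->
     forall beta : {fraction {poly k}},
       (Q_polynomial W beta /\ omega_spans_Lspace W beta) <->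
       (exists R : {poly k}, beta = alpha + R%:F)).
Proof.
case: n n_ge3 W W_coprime W_degree => // m m_ge2 W W_coprime W_degree.
have m_gt0 : (0 < m)%N by rewrite ltnW.
have chP : 2%N \in [pchar {poly k}] := rmorph_pchar (@polyC k) chark.
have chF : 2%N \in [pchar {fraction {poly k}}] :=
  rmorph_pchar (@FracField.tofrac {poly k}) chP.
have D0 : (Moore W)%:F != 0 :> {fraction {poly k}}.
  rewrite tofrac_eq0; apply: Moore_neq0 => // c c0.
  by rewrite -size_poly_gt0 W_degree.
have Lspace (P : {poly k}) : Q_polynomial W (P%:F / (Moore W)%:F) ->
    omega_spans_Lspace W (P%:F / (Moore W)%:F).
  move=> /fin_all_exists [q qE].
  exact: (omega_Lspace_of_numerator chark W_degree qE m_gt0).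
split.
  have [P PQ] := Q_polynomial_exists chark W_coprime W_degree.
  by exists (P%:F / (Moore W)%:F); split; [exists P | split=> //; apply: Lspace].
move=> alpha [[P alphaE] [Qa _]] beta; split=> [[Qb _]|[R ->]].
  exact: (Q_polynomial_diff chark W_coprime Qa Qb).
(* [alpha + R] again has denominator [Moore W], so (ii) will follow from (i). *)
suff Qb : Q_polynomial W (alpha + R%:F).
  split=> //; move: Qb.
  have -> : alpha + R%:F = (P + R * Moore W)%:F / (Moore W)%:F.
    by rewrite tofracD tofracM mulrDl mulfK // alphaE.
  exact: Lspace.
(* Replacing alpha by alpha + R adds the square of R V_i to Q_i. *)
move=> i; have [p pE] := Qa i; exists (p + R ^+ 2 * Vpol W i ^+ 2).
have := sqr_sub_pchar2 chF alpha (alpha + R%:F) (Vpol W i)%:F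
  ((Vpol W i)%:F ^+ 4 / (Moore W)%:F ^+ 2) 'X%:F.
rewrite addrAC subrr add0r => /eqP; rewrite eq_sym subr_eq => /eqP.
rewrite -/(Qrat W alpha i) pE -/(Qrat W (alpha + R%:F) i) => ->.
by rewrite addrC tofracD tofracM !tofracXn exprMn.
Qed.
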